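(* Let $E,Q\in M_n(\mathbb C)$ be such that $E^*Q$ is skew-Hermitian and at least one of $E$ and $Q$ is nonsingular. Then there exist $U,V\in GL_n(\mathbb C)$ such that $$(UEV,U^{-*}QV)=\bigoplus_{l=1}^{n}(A_l,B_l),$$ where each $(A_l,B_l)$ is a pair of $1\times1$ matrices with $(A_l,B_l)\in\{(1,i),(1,-i),(1,0)\}$ if $E$ is nonsingular, and $(A_l,B_l)\in\{(1,i),(1,-i),(0,1)\}$ if $Q$ is nonsingular (here $i=\sqrt{-1}$). The canonical form is uniquely determined by $(E,Q)$ up to permutation of summands.
   Context: $M_n(\mathbb C)$ is the set of $n\times n$ complex matrices, $GL_n(\mathbb C)$ the nonsingular ones, $A^*$ is the conjugate transpose, $A^{-*}=(A^{-1})^*$. The direct sum of pairs is $(A,B)\oplus(C,D):=(A\oplus C,B\oplus D)$, where $\oplus$ on matrices is the block-diagonal direct sum. *)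

(* Defs.v *)
From mathcomp Require Import all_boot all_order all_fingroup all_algebra.
From mathcomp Require Import spectral sesquilinear.
From mathcomp Require Import reals complex.

Set Implicit Arguments.
Unset Strict Implicit.
Unset Printing Implicit Defensive.

Import Order.TTheory GRing.Theory Num.Theory.

Local Open Scope ring_scope.
Local Open Scope sesquilinear_scope.

(* [M \is skewhermmx] unfolds to [M = (-1) ^+ true *: M^t*]. *)
Notation skewhermmx := (hermitianmx _ true Num.conj).

(* 1 x 1 blocks are identified with their entries. *)
Definition dsum_pairs (C : nzRingType) n (d : 'I_n -> C * C) : 'M[C]_n * 'M[C]_n :=
  (diag_mx (\row_l (d l).1), diag_mx (\row_l (d l).2)).

Definition pair_reduces_to (C : numClosedFieldType) n (E Q : 'M[C]_n)
    (d : 'I_n -> C * C) : Prop :=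
  exists U V : 'M[C]_n,
    [/\ U \in unitmx, V \in unitmx
      & (U *m E *m V, (invmx U)^t* *m Q *m V) = dsum_pairs d].

(* If E and Q are both nonsingular, then both restrictions apply. *)
Definition canonical_pair_form (C : numClosedFieldType) n (E Q : 'M[C]_n)
    (d : 'I_n -> C * C) : Prop :=
  [/\ pair_reduces_to E Q d,
      E \in unitmx -> forall l, d l \in [:: (1, 'i); (1, - 'i); (1, 0)]
    & Q \in unitmx -> forall l, d l \in [:: (1, 'i); (1, - 'i); (0, 1)]].

(* Main.v *)
(* The transformation (E, Q) -> (UEV, U^-* Q V) acts on H = E^*Q by
   *-congruence: H -> V^* H V.  By the spectral theorem and a rescaling, the
   Hermitian matrix -iH is *-congruent to a diagonal matrix k with entries in
   {1, -1, 0}.  If E is nonsingular then U = (EV)^-1 gives the canonical form.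
   If Q is nonsingular, put B = diag(b_l), where b_l = i, -i, 1 according to
   k_l = 1, -1, 0; then B is unitary and U = B V^* Q^* gives the canonical form.
   Conversely the pair (A_l, B_l) is determined by conj(A_l) B_l, and Sylvester's
   law of inertia for -iH determines these numbers up to a permutation. *)
Require Import Defs.
From mathcomp Require Import all_boot all_order all_fingroup all_algebra.
From mathcomp Require Import spectral sesquilinear.
From mathcomp Require Import reals complex.

Local Open Scope ring_scope.
Local Open Scope sesquilinear_scope.

Import Order.TTheory GRing.Theory Num.Theory.
Set Implicit Arguments.
Unset Strict Implicit.

(** * Conjugate-transpose algebra *)

Section ConjugateTranspose.
Context {C : numClosedFieldType}.

Lemma trmxC_mul m n p (A : 'M[C]_(m, n)) (B : 'M[C]_(n, p)) :
  (A *m B)^t* = B^t* *m A^t*.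
Proof. by rewrite trmx_mul map_mxM. Qed.

Lemma trmxC_inv n (A : 'M[C]_n) : (invmx A)^t* = invmx (A^t*).
Proof. by rewrite trmx_inv map_invmx. Qed.

Lemma trmxC_unitmx n (A : 'M[C]_n) : (A^t* \in unitmx) = (A \in unitmx).
Proof. by rewrite map_unitmx unitmx_tr. Qed.

Lemma trmxC_diag n (d : 'rV[C]_n) :
  (diag_mx d)^t* = diag_mx (map_mx Num.conj d).
Proof. by rewrite tr_diag_mx map_diag_mx. Qed.

End ConjugateTranspose.

(** * Invertible diagonals, counting and dimension arguments *)

Lemma diag_mx_unit (F : fieldType) n (d : 'rV[F]_n) :
  (diag_mx d \in unitmx) = [forall l, d 0 l != 0].
Proof.
rewrite unitmxE unitfE det_diag.
by apply/prodf_neq0/forallP => d_neq0 *; apply: d_neq0.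
Qed.

(** Whatever is neither [a] nor [b] must be [c], so its multiplicity is the size minus the two given
    counts. This serves to compare lists of signs. *)
Lemma perm_eq_count2 (T : eqType) (a b c : T) (s t : seq T) :
  a != b -> {subset s <= [:: a; b; c]} -> {subset t <= [:: a; b; c]} ->
  size s = size t -> count_mem a s = count_mem a t ->
  count_mem b s = count_mem b t -> perm_eq s t.
Proof.
move=> neq_ab s_abc t_abc eq_size eq_a eq_b.
have count_rest r : (count (predC (pred2 a b)) r =
    size r - (count_mem a r + count_mem b r))%N.
  suff <-: count (pred2 a b) r = (count_mem a r + count_mem b r)%N.
    by rewrite -(count_predC (pred2 a b)) addKn.
  rewrite -count_predUI -[LHS]addn0; congr (_ + _)%N.
  rewrite -(count_pred0 r); apply: eq_count => x /=; apply/esym.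
  by apply: contraNF neq_ab => /andP[/eqP-> /eqP->].
apply/allP => x; rewrite mem_cat => xst.
have [/eqP->|neq_xa] := boolP (x == a); first exact/eqP.
have [/eqP->|neq_xb] := boolP (x == b); first exact/eqP.
have ex : x = c.
  have : x \in [:: a; b; c] by case/orP: xst => [/s_abc|/t_abc].
  by rewrite !inE (negPf neq_xa) (negPf neq_xb) => /eqP.
have count_x r : {subset r <= [:: a; b; c]} ->
    count_mem x r = count (predC (pred2 a b)) r.
  move=> r_abc; apply: eq_in_count => y /r_abc; rewrite !inE /= -ex.
  have [->|_] := eqVneq y a; first by rewrite [a == x]eq_sym (negPf neq_xa).
  have [->|_] := eqVneq y b; first by rewrite [b == x]eq_sym (negPf neq_xb).
  by move=> /= ->.
by rewrite /= (count_x s) // (count_x t) // !count_rest eq_size eq_a eq_b.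
Qed.

(** The conditions say that [y] lies in the left kernel of a matrix with [n] rows and [#|A| + #|B|]
    columns, whose rank is therefore below [n]. *)
Lemma exists_vanishing_row (F : fieldType) n (W : 'M[F]_n) (A B : {set 'I_n}) :
  (#|A| + #|B| < n)%N ->
  exists y : 'rV[F]_n,
    [/\ y != 0, {in A, forall l, y 0 l = 0}
      & {in B, forall l, (y *m W) 0 l = 0}].
Proof.
move=> ltABn.
pose M := row_mx (colsub (@enum_val _ (mem A)) (1%:M : 'M[F]_n))
                 (colsub (@enum_val _ (mem B)) W).
have /rowV0Pn[y /sub_kermxP yM0 y_neq0]: kermx M != 0.
  rewrite -mxrank_eq0 mxrank_ker subn_eq0 -ltnNge.
  exact: leq_ltn_trans (rank_leq_col _) ltABn.
move: yM0; rewrite mul_mx_row -[RHS]row_mx0 => /eq_row_mx[yA0 yB0].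
exists y; split=> // l lS.
  move/rowP/(_ (enum_rank_in lS l)): yA0.
  by rewrite mulmx_colsub mulmx1 !mxE enum_rankK_in.
move/rowP/(_ (enum_rank_in lS l)): yB0.
by rewrite mulmx_colsub [LHS]mxE enum_rankK_in // => ->; rewrite mxE.
Qed.

(** * Sylvester's law of inertia for real diagonal forms *)

Section Inertia.
Context {C : numClosedFieldType}.

Lemma diag_form n (k y : 'rV[C]_n) :
  (y *m diag_mx k *m y^t*) 0 0 = \sum_l k 0 l * `|y 0 l| ^+ 2.
Proof.
rewrite mxE; apply: eq_bigr => l _.
by rewrite mul_mx_diag !mxE normCK mulrAC mulrC.
Qed.

(* A row vector supported on the positive part of k' whose image under W
   vanishes on the positive part of k gives the two forms opposite signs. *)
Lemma leq_pos_inertia n (W : 'M[C]_n) (k k' : 'rV[C]_n) :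
  k \is a realmx -> k' \is a realmx ->
  W *m diag_mx k *m W^t* = diag_mx k' ->
  (#|[set l | (0 < k' 0 l)%R]| <= #|[set l | (0 < k 0 l)%R]|)%N.
Proof.
move=> /mxOverP k_real /mxOverP k'_real Wkk'; rewrite leqNgt.
apply/negP => ltkk'.
set pos' := [set l | 0 < k' 0 l] in ltkk'; set pos := [set l | _] in ltkk'.
(* The negated claim [#|pos| < #|pos'|] is exactly the count needed for the complement of [pos']
   together with [pos]. *)
have [|y [y_neq0 y_pos' yW_pos]] :=
  @exists_vanishing_row _ _ W (~: pos') pos.
  by rewrite -[ltnRHS](card_ord n) -(cardsC pos') addnC ltn_add2r.
have : (y *m diag_mx k' *m y^t*) 0 0 =
       ((y *m W) *m diag_mx k *m (y *m W)^t*) 0 0.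
  by rewrite -Wkk' trmxC_mul !mulmxA.
rewrite !diag_form => eq_sums.
have le0 : \sum_l k 0 l * `|(y *m W) 0 l| ^+ 2 <= 0.
  apply: sumr_le0 => l _; have [l_pos|] := boolP (l \in pos).
    by rewrite yW_pos // normr0 expr0n mulr0.
  rewrite inE -real_leNgt ?real0 // => kl_le0.
  by rewrite mulr_le0_ge0 // exprn_ge0.
have ge0 l : 0 <= k' 0 l * `|y 0 l| ^+ 2.
  have [|l_pos] := boolP (l \in pos').
    by rewrite inE => /ltW ?; rewrite mulr_ge0 // exprn_ge0.
  by rewrite y_pos' ?in_setC // normr0 expr0n mulr0.
(* The common value is both nonnegative and nonpositive, so every term of the [k'] sum vanishes.
   Hence [y] is zero on [pos'] too, a contradiction. *)
have /eqP : \sum_l k' 0 l * `|y 0 l| ^+ 2 = 0.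
  by apply: le_anti; rewrite {1}eq_sums le0 sumr_ge0.
rewrite psumr_eq0 // => /allP sum0.
case/negP: y_neq0; apply/eqP/rowP => l; rewrite [RHS]mxE.
have [|l_pos] := boolP (l \in pos'); last by rewrite y_pos' ?in_setC.
rewrite inE => /gt_eqF kl_neq0; have := sum0 l (mem_index_enum l).
by rewrite mulf_eq0 kl_neq0 expf_eq0 normr_eq0 => /eqP.
Qed.

Lemma pos_inertia n (W : 'M[C]_n) (k k' : 'rV[C]_n) :
  W \in unitmx -> k \is a realmx -> k' \is a realmx ->
  W *m diag_mx k *m W^t* = diag_mx k' ->
  #|[set l | (0 < k' 0 l)%R]| = #|[set l | (0 < k 0 l)%R]|.
Proof.
move=> Wu k_real k'_real Wkk'; apply/eqP; rewrite eqn_leq.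
rewrite (leq_pos_inertia k_real k'_real Wkk') /=.
apply: (@leq_pos_inertia _ (invmx W)) => //.
by rewrite -Wkk' trmxC_inv !mulmxA mulVmx // mul1mx mulmxK ?trmxC_unitmx.
Qed.

Lemma real_sgr_cp (x : C) : x \is Num.real ->
  [/\ (Num.sg x == 1) = (0 < x), (Num.sg x == -1) = (x < 0)
    & Num.sg x \in [:: 1; -1; 0]].
Proof.
move=> x_real; have neq1N1 : (1 == -1 :> C) = false.
  by rewrite gt_eqF // (lt_trans (ltrN10 _) ltr01).
case: (real_ltgt0P x_real) => [x_gt0|x_lt0|->].
- by rewrite gtr0_sg // eqxx neq1N1 inE eqxx.
- by rewrite ltr0_sg // eqxx eq_sym neq1N1 !inE eqxx orbT.
- by rewrite sgr0 !inE eqxx !orbT eq_sym oner_eq0 eq_sym oppr_eq0 oner_eq0.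
Qed.

(** A real sign takes only three values, so the numbers of positive and negative entries fix the
    multiset of signs. *)
Lemma perm_sgr n (k k' : 'rV[C]_n) :
  k \is a realmx -> k' \is a realmx ->
  #|[set l | (0 < k' 0 l)%R]| = #|[set l | (0 < k 0 l)%R]| ->
  #|[set l | (k' 0 l < 0)%R]| = #|[set l | (k 0 l < 0)%R]| ->
  exists s : {perm 'I_n}, forall l, Num.sg (k' 0 l) = Num.sg (k 0 (s l)).
Proof.
move=> /mxOverP k_real /mxOverP k'_real eq_pos eq_neg.
pose sgs (x : 'rV[C]_n) := [tuple Num.sg (x 0 l) | l < n].
have count_sgs a (x : 'rV[C]_n) (P : pred C) :
    (forall l, (Num.sg (x 0 l) == a) = P (x 0 l)) ->
    count_mem a (sgs x) = #|[set l | P (x 0 l)]|.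
  move=> sgP; rewrite /= count_map cardsE cardE size_filter enumT.
  by apply: eq_count => l; rewrite /= sgP.
suff /tuple_permP[s eq_s]: perm_eq (sgs k') (sgs k).
  exists s => l; have := congr1 (fun t => nth 0 t l) eq_s.
  by rewrite !nth_mktuple tnth_mktuple.
have sgs_sub (x : 'rV[C]_n) : (forall i j, x i j \is Num.real) ->
    {subset sgs x <= [:: 1; -1; 0]}.
  by move=> x_real _ /mapP[l _ ->]; have [] := real_sgr_cp (x_real 0 l).
have sgs1 (x : 'rV[C]_n) : (forall i j, x i j \is Num.real) ->
    count_mem 1 (sgs x) = #|[set l | (0 < x 0 l)%R]|.
  move=> x_real; apply: (count_sgs _ _ (fun t => 0 < t)) => l.
  by have [] := real_sgr_cp (x_real 0 l).
have sgsN1 (x : 'rV[C]_n) : (forall i j, x i j \is Num.real) ->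
    count_mem (-1) (sgs x) = #|[set l | (x 0 l < 0)%R]|.
  move=> x_real; apply: (count_sgs _ _ (fun t => t < 0)) => l.
  by have [] := real_sgr_cp (x_real 0 l).
apply: (@perm_eq_count2 _ 1 (-1) 0); rewrite ?size_tuple //.
- by rewrite gt_eqF // (lt_trans (ltrN10 _) ltr01).
- exact: sgs_sub.
- exact: sgs_sub.
- by rewrite !sgs1.
- by rewrite !sgsN1.
Qed.

Lemma sylvester_inertia n (W : 'M[C]_n) (k k' : 'rV[C]_n) :
  W \in unitmx -> k \is a realmx -> k' \is a realmx ->
  W *m diag_mx k *m W^t* = diag_mx k' ->
  exists s : {perm 'I_n}, forall l, Num.sg (k' 0 l) = Num.sg (k 0 (s l)).
Proof.
move=> Wu k_real k'_real Wkk'; apply: perm_sgr => //.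
  exact: pos_inertia Wkk'.
(* Negating both diagonal matrices preserves the congruence and turns negative entries into positive
   ones. *)
have setN (x : 'rV[C]_n) :
    [set l | (x 0 l < 0)%R] = [set l | (0 < (- x) 0 l)%R].
  by apply/setP => l; rewrite !inE mxE oppr_gt0.
have diagN (x : 'rV[C]_n) : diag_mx (- x) = - diag_mx x by rewrite raddfN.
have realN (x : 'rV[C]_n) : x \is a realmx -> - x \is a realmx.
  by move=> /mxOverP x_real; apply/mxOverP => i j; rewrite mxE rpredN.
rewrite !setN; apply: (pos_inertia Wu).
- exact: realN.
- exact: realN.
- by rewrite !diagN mulmxN mulNmx Wkk'.
Qed.

End Inertia.

(** * Reduction to canonical form and its uniqueness *)

Section CanonicalForm.
Context {C : numClosedFieldType}.

Lemma hermitian_congr_sgr n (K : 'M[C]_n) : K \is hermsymmx ->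
  exists V : 'M[C]_n, exists k : 'rV[C]_n,
    [/\ V \in unitmx, forall l, k 0 l \in [:: 1; -1; 0]
      & V^t* *m K *m V = diag_mx k].
Proof.
move=> K_herm; have /mxOverP r_real := hermitian_spectral_diag_real K_herm.
have /hermitian_normalmx/orthomx_spectralP := K_herm.
set P := spectralmx K; set r := spectral_diag K in r_real *.
have P_unitary : P \is unitarymx := spectral_unitarymx K.
rewrite invmx_unitary // => Kdef.
(* Scaling by [t] divides a nonzero eigenvalue by its modulus, which leaves its sign; the value 1 at
   zero eigenvalues keeps the scaling invertible. *)
pose t := \row_l (if r 0 l == 0 then 1 else (sqrtC `|r 0 l|)^-1).
exists (P^t* *m diag_mx t), (\row_l Num.sg (r 0 l)); split.
- rewrite unitmx_mul trmxC_unitmx unitarymx_unit //= diag_mx_unit.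
  apply/forallP => l; rewrite mxE; case: ifPn => [_|r_neq0].
    exact: oner_neq0.
  by rewrite invr_eq0 sqrtC_eq0 normr_eq0.
- by move=> l; rewrite mxE; have [] := real_sgr_cp (r_real 0 l).
rewrite trmxC_mul trmxCK Kdef !mulmxA !mulmxtVK // trmxC_diag !mulmx_diag.
congr diag_mx; apply/rowP => l; rewrite !mxE; case: ifPn => [/eqP->|r_neq0].
  by rewrite mulr0 mul0r sgr0.
rewrite geC0_conj ?invr_ge0 ?sqrtC_ge0 // mulrAC -expr2 exprVn sqrtCK mulrC.
by rewrite {1}[r 0 l]realEsg // mulfK // normr_eq0.
Qed.

Lemma skew_hermitian_congr_sgr n (H : 'M[C]_n) : H \is skewhermmx ->
  exists V : 'M[C]_n, exists k : 'rV[C]_n,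
    [/\ V \in unitmx, forall l, k 0 l \in [:: 1; -1; 0]
      & V^t* *m H *m V = diag_mx ('i *: k)].
Proof.
move=> /is_hermitianmxP; rewrite expr1 scaleN1r => Hskew.
have : - 'i *: H \is hermsymmx.
  apply/is_hermitianmxP; rewrite expr0 scale1r linearZ /= map_mxZ /=.
  by rewrite {1}Hskew rmorphN /= conjCi opprK scalerN scaleNr opprK.
case/hermitian_congr_sgr => V [k [Vu kP VHV]]; exists V, k; split=> //.
rewrite linearZ /= -VHV -scalemxAr -scalemxAl scalerA.
by rewrite mulrN -expr2 sqrCi opprK scale1r.
Qed.

(* The last argument is the sign of the eigenvalue of [- 'i *: (E^t* *m Q)];
   [z] stands for the pair (1, 0) or (0, 1) used for the eigenvalue 0. *)
Definition pair_of_sign (z : C * C) (t : C) : C * C :=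
  if t == 1 then (1, 'i) else if t == -1 then (1, - 'i) else z.

(** The factors coming from [U] cancel in the product of the adjoint of [U *m E *m V] with the
    second matrix. *)
Lemma pair_reduces_congr n (E Q : 'M[C]_n) (d : 'I_n -> C * C) :
  pair_reduces_to E Q d ->
  exists2 V : 'M[C]_n, V \in unitmx &
    V^t* *m (E^t* *m Q) *m V = diag_mx (\row_l ((d l).1^* * (d l).2)).
Proof.
move=> [U [V [Uu Vu [eqE eqQ]]]]; exists V => //.
transitivity ((U *m E *m V)^t* *m ((invmx U)^t* *m Q *m V)).
  rewrite !trmxC_mul trmxC_inv !mulmxA; congr (_ *m _ *m _).
  by rewrite mulmxK ?trmxC_unitmx.
rewrite eqE eqQ trmxC_diag mulmx_diag.
by congr diag_mx; apply/rowP => l; rewrite !mxE.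
Qed.

(** When both matrices are nonsingular, this excludes (1, 0) and (0, 1) from the form. *)
Lemma pair_reduces_neq0 n (E Q : 'M[C]_n) (d : 'I_n -> C * C) :
  pair_reduces_to E Q d ->
  (E \in unitmx -> forall l, (d l).1 != 0) /\
  (Q \in unitmx -> forall l, (d l).2 != 0).
Proof.
move=> [U [V [Uu Vu [eqE eqQ]]]]; split=> Xu l.
  have : diag_mx (\row_l (d l).1) \in unitmx.
    by rewrite -eqE !unitmx_mul Uu Vu Xu.
  by rewrite diag_mx_unit => /forallP/(_ l); rewrite mxE.
have : diag_mx (\row_l (d l).2) \in unitmx.
  by rewrite -eqQ !unitmx_mul trmxC_unitmx unitmx_inv Uu Vu Xu.
by rewrite diag_mx_unit => /forallP/(_ l); rewrite mxE.
Qed.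

(** Both diagonal forms are *-congruent to the same matrix, so their signs agree up to a
    permutation; the hypothesis on [z] makes it the pair of sign 0, so the sign determines the
    pair. *)
Lemma reduced_pair_perm n (E Q : 'M[C]_n) (z : C * C) (d d' : 'I_n -> C * C) :
  z.1^* * z.2 = 0 ->
  pair_reduces_to E Q d -> (forall l, d l \in [:: (1, 'i); (1, - 'i); z]) ->
  pair_reduces_to E Q d' -> (forall l, d' l \in [:: (1, 'i); (1, - 'i); z]) ->
  exists s : {perm 'I_n}, forall l, d' l = d (s l).
Proof.
move=> z0 dEQ dP d'EQ d'P.
pose sgn (p : C * C) := - 'i * (p.1^* * p.2).
have sgnP p : p \in [:: (1, 'i); (1, - 'i); z] ->
    sgn p \is Num.real /\ p = pair_of_sign z (Num.sg (sgn p)).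
  have ii : 'i * 'i = -1 :> C by rewrite -expr2 sqrCi.
  have neqN11 : (-1 == 1 :> C) = false.
    by rewrite lt_eqF // (lt_trans (ltrN10 _) ltr01).
  rewrite /sgn /pair_of_sign !inE => /or3P[] /eqP->.
  - by rewrite /= conjC1 mul1r mulNr ii opprK sgr1 eqxx real1.
  - by rewrite /= conjC1 mul1r mulrNN ii sgrN1 neqN11 eqxx rpredN real1.
  - by rewrite z0 mulr0 sgr0 real0 !(eq_sym 0) oppr_eq0 oner_eq0.
have [V Vu VHV] := pair_reduces_congr dEQ.
have [V' V'u V'HV'] := pair_reduces_congr d'EQ.
have diagZ (e : 'I_n -> C * C) :
    diag_mx (\row_l sgn (e l)) = - 'i *: diag_mx (\row_l ((e l).1^* * (e l).2)).
  by rewrite -linearZ /=; congr diag_mx; apply/rowP => l; rewrite !mxE.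
have sgn_real (e : 'I_n -> C * C) :
    (forall l, e l \in [:: (1, 'i); (1, - 'i); z]) ->
    \row_l sgn (e l) \is a realmx.
  move=> eP; apply/mxOverP => i l.
  by rewrite mxE; have [] := sgnP _ (eP l).
(* This matrix undoes the congruence by [V] and then applies the one by [V']. *)
have [||||s s_sgn] := @sylvester_inertia C n (V'^t* *m invmx (V^t*))
  (\row_l sgn (d l)) (\row_l sgn (d' l)).
- by rewrite unitmx_mul unitmx_inv !trmxC_unitmx Vu V'u.
- exact: sgn_real.
- exact: sgn_real.
- rewrite !diagZ -scalemxAr -scalemxAl -VHV -V'HV'; congr (_ *: _).
  rewrite trmxC_mul trmxC_inv !trmxCK !mulmxA mulmxKV ?trmxC_unitmx //.
  by rewrite mulmxK.
exists s => l; have [_ ->] := sgnP _ (d'P l); have [_ ->] := sgnP _ (dP (s l)).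
by have := s_sgn l; rewrite !mxE => ->.
Qed.

Lemma pair_reduces_unitl n (E Q V : 'M[C]_n) (k : 'rV[C]_n) :
  E \in unitmx -> V \in unitmx -> (forall l, k 0 l \in [:: 1; -1; 0]) ->
  V^t* *m (E^t* *m Q) *m V = diag_mx ('i *: k) ->
  pair_reduces_to E Q (fun l => pair_of_sign (1, 0) (k 0 l)).
Proof.
move=> Eu Vu kP VHV; exists (invmx (E *m V)), V.
have EVu : E *m V \in unitmx by rewrite unitmx_mul Eu.
split; rewrite ?unitmx_inv //; congr pair.
  rewrite -mulmxA mulVmx // -diag_const_mx; congr diag_mx.
  by apply/rowP => l; rewrite !mxE /pair_of_sign; do 2?case: ifP.
(* With this [U], the factor [(invmx U)^t*] is the adjoint of [E *m V], so the second matrix is the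
   congruence [VHV]. *)
rewrite invmxK trmxC_mul -[_ *m E^t* *m Q]mulmxA VHV; congr diag_mx.
apply/rowP => l; rewrite !mxE /pair_of_sign.
have := kP l; rewrite !inE; case: eqP => [->|_] /=; first by rewrite mulr1.
by case: eqP => [->|_] /= => [|/eqP->]; rewrite ?mulrN1 ?mulr0.
Qed.

Lemma pair_reduces_unitr n (E Q V : 'M[C]_n) (k : 'rV[C]_n) :
  E^t* *m Q \is skewhermmx ->
  Q \in unitmx -> V \in unitmx -> (forall l, k 0 l \in [:: 1; -1; 0]) ->
  V^t* *m (E^t* *m Q) *m V = diag_mx ('i *: k) ->
  pair_reduces_to E Q (fun l => pair_of_sign (0, 1) (k 0 l)).
Proof.
move=> /is_hermitianmxP; rewrite expr1 scaleN1r trmxC_mul trmxCK => skewEQ.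
move=> Qu Vu kP VHV; pose b := \row_l (pair_of_sign (0, 1) (k 0 l)).2.
have B_unitary : diag_mx b \is unitarymx.
  apply/unitarymxP; rewrite trmxC_diag mulmx_diag -diag_const_mx.
  congr diag_mx; apply/rowP => l; rewrite !mxE /pair_of_sign -normCK.
  by do 2?case: ifP => _; rewrite ?normrN ?normCi ?normr1 expr1n.
have Bu := unitarymx_unit B_unitary.
exists (diag_mx b *m V^t* *m Q^t*), V.
split=> //; first by rewrite !unitmx_mul !trmxC_unitmx Bu Vu Qu.
congr pair.
  (* Skewness replaces the product of [Q^t*] and [E] by minus [E^t* *m Q], so the entries become
     minus [b] times ['i] times [k]: 1 for signs 1 and -1, and 0 for sign 0. *)
  have -> : diag_mx b *m V^t* *m Q^t* *m E *m V =
      - (diag_mx b *m (V^t* *m (E^t* *m Q) *m V)).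
    by rewrite skewEQ !(mulmxN, mulNmx) opprK !mulmxA.
  rewrite VHV mulmx_diag -raddfN; congr diag_mx.
  apply/rowP => l; rewrite !mxE /pair_of_sign.
  have ii : 'i * 'i = -1 :> C by rewrite -expr2 sqrCi.
  have := kP l; rewrite !inE; case: eqP => [->|_] /=.
    by rewrite mulr1 ii opprK.
  case: eqP => [->|_] /= => [|/eqP->]; last by rewrite !mulr0 oppr0.
  by rewrite mulrN1 mulrNN ii opprK.
have -> : diag_mx (\row_l (pair_of_sign (0, 1) (k 0 l)).2) = diag_mx b by [].
(* Unitarity of B makes the adjoint of [U] equal to Q V B^-1, and its inverse times Q V is B. *)
rewrite trmxC_inv !trmxC_mul !trmxCK -(invmx_unitary B_unitary) mulmxA -mulmxA.
apply: (canLR (mulKmx _)).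
  by rewrite !unitmx_mul unitmx_inv Bu Vu Qu.
by rewrite mulmxKV.
Qed.

End CanonicalForm.
Unset Implicit Arguments.
Set Strict Implicit.

Theorem theorem3p8 (R : realType) (n : nat) (E Q : 'M[R[i]%C]_n)
    (skewEQ : E^t* *m Q \is skewhermmx)
    (nonsingEQ : E \in unitmx \/ Q \in unitmx) :
  exists d : 'I_n -> R[i]%C * R[i]%C,
    canonical_pair_form E Q d /\
    forall d' : 'I_n -> R[i]%C * R[i]%C, canonical_pair_form E Q d' ->
      exists s : {perm 'I_n}, forall l : 'I_n, d' l = d (s l).
Proof.
have [V [k [Vu kP VHV]]] := skew_hermitian_congr_sgr skewEQ.
have signP (z : R[i]%C * R[i]%C) t :
  pair_of_sign z t \in [:: (1, 'i); (1, - 'i); z].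
  rewrite /pair_of_sign !inE; do 2?case: ifP => _; rewrite eqxx ?orbT //.
have [Eu|Qu] := nonsingEQ.
  have red := pair_reduces_unitl Eu Vu kP VHV.
  exists (fun l => pair_of_sign (1, 0) (k 0 l)); split.
    (* If [Q] is nonsingular as well, second components are nonzero, so (1, 0) cannot occur and the
       other list is respected too. *)
    split=> // Qu l; have := (pair_reduces_neq0 red).2 Qu l.
    by have := signP (1, 0) (k 0 l); rewrite !inE => /or3P[] /eqP->;
      rewrite ?eqxx ?orbT.
  move=> d' [red' d'P _]; apply: (reduced_pair_perm _ red _ red') => //=.
    by rewrite mulr0.
  exact: d'P.
have red := pair_reduces_unitr skewEQ Qu Vu kP VHV.
exists (fun l => pair_of_sign (0, 1) (k 0 l)); split.
  (* Symmetrically, a nonsingular [E] rules out (0, 1). *)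
  split=> // Eu l; have := (pair_reduces_neq0 red).1 Eu l.
  by have := signP (0, 1) (k 0 l); rewrite !inE => /or3P[] /eqP->;
    rewrite ?eqxx ?orbT.
move=> d' [red' _ d'P]; apply: (reduced_pair_perm _ red _ red') => //=.
  by rewrite conjC0 mul0r.
exact: d'P.
Qed.
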